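(* Let $Q:L^2(\mathbb{R}_+)\times L^2(\mathbb{R}_+)\to L^\infty(\mathrm{Aff})$ be a sesquilinear map (linear in the first and anti-linear in the second argument). Assume that for all $\psi,\phi\in L^2(\mathbb{R}_+)$ the function $Q(\psi,\phi)$ is a continuous function on $\mathrm{Aff}$ satisfying the covariance property $$Q(U(-x,a)\psi,U(-x,a)\phi)(y,b)=Q(\psi,\phi)((y,b)\cdot(x,a))\qquad\text{for all }(x,a),(y,b)\in\mathrm{Aff},$$ and the estimate $$|Q(\psi,\phi)(0,1)|\le C\,\|\psi\|_{L^2(\mathbb{R}_+)}\|\phi\|_{L^2(\mathbb{R}_+)}$$ for a constant $C$ independent of $\psi,\phi$. Then there exists a unique bounded operator $S$ on $L^2(\mathbb{R}_+)$ such that $Q=Q_S$.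
   Context: $\mathrm{Aff}=\mathbb{R}\times\mathbb{R}_+$, $\mathbb{R}_+=(0,\infty)$, is the affine group with $(x,a)\cdot(y,b)=(ay+x,ab)$ and identity $(0,1)$. $L^2(\mathbb{R}_+)=L^2(\mathbb{R}_+,r^{-1}dr)$, with unitary representation $U(x,a)\psi(r)=e^{2\pi i xr}\psi(ar)$. For a bounded operator $S$ on $L^2(\mathbb{R}_+)$, $$Q_S(\psi,\phi)(x,a):=\langle SU(-x,a)\psi,U(-x,a)\phi\rangle_{L^2(\mathbb{R}_+)}$$ (inner product linear in the first argument). The maps of this form constitute the affine Cohen class. *)

(* Defs.v *)
From HB Require Import structures.
From mathcomp Require Import all_boot all_order all_algebra.
From mathcomp Require Export complex.
From mathcomp Require Import all_classical all_reals all_analysis measurable_realfun ess_sup_inf.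
Import Order.TTheory GRing.Theory Num.Theory.
Import numFieldNormedType.Exports.
Import ComplexField.Normc.

Set Implicit Arguments.
Unset Strict Implicit.
Unset Printing Implicit Defensive.

Local Open Scope classical_set_scope.
Local Open Scope complex_scope.
Local Open Scope ring_scope.

Section ComplexLebesgue.
Context d (T : measurableType d) (R : realType).
Variable mu : {measure set T -> \bar R}.
Implicit Types f g : T -> R[i].

Definition cmeasurable f :=
  measurable_fun setT (fun x => complex.Re (f x)) /\
  measurable_fun setT (fun x => complex.Im (f x)).

(* Representatives of the complex L^p(mu); R[i] carries no measurable structure
   in the library, so measurability is that of the two components. *)
Definition cLfun (p : \bar R) : {pred T -> R[i]} :=
  mem [set f | cmeasurable f /\ finite_norm mu p (fun x => normc (f x))].

Definition cintegral f : R[i] :=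
  (\int[mu]_x complex.Re (f x)) +i* (\int[mu]_x complex.Im (f x)).

Lemma cmeasurableD f g :
  cmeasurable f -> cmeasurable g -> cmeasurable (f + g).
Proof.
move=> [f1 f2] [g1 g2]; split.
  rewrite (_ : (fun _ => _) = (fun x => complex.Re (f x)) \+ (fun x => complex.Re (g x))).
    exact: measurable_funD.
  by apply/funext => x /=; rewrite fctE; case: (f x); case: (g x).
rewrite (_ : (fun _ => _) = (fun x => complex.Im (f x)) \+ (fun x => complex.Im (g x))).
  exact: measurable_funD.
by apply/funext => x /=; rewrite fctE; case: (f x); case: (g x).
Qed.

Lemma cmeasurableM f g :
  cmeasurable f -> cmeasurable g -> cmeasurable (fun x => f x * g x).
Proof.
move=> [f1 f2] [g1 g2]; split.
  rewrite (_ : (fun _ => _) =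
      (fun x => complex.Re (f x)) \* (fun x => complex.Re (g x)) \-
      (fun x => complex.Im (f x)) \* (fun x => complex.Im (g x))).
    by apply: measurable_funB; apply: measurable_funM.
  by apply/funext => x /=; case: (f x); case: (g x).
rewrite (_ : (fun _ => _) =
    (fun x => complex.Re (f x)) \* (fun x => complex.Im (g x)) \+
    (fun x => complex.Im (f x)) \* (fun x => complex.Re (g x))).
  by apply: measurable_funD; apply: measurable_funM.
by apply/funext => x /=; case: (f x); case: (g x).
Qed.

Lemma cmeasurable_cst (c : R[i]) : cmeasurable (fun=> c).
Proof. by split; exact: measurable_cst. Qed.

Lemma cmeasurable_normc f :
  cmeasurable f -> measurable_fun setT (fun x => normc (f x)).
Proof.
move=> [f1 f2].
rewrite (_ : (fun _ => _) = (@Num.sqrt R) \o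
   ((fun x => complex.Re (f x) ^+ 2) \+ (fun x => complex.Im (f x) ^+ 2))).
  apply: measurableT_comp.
    exact: continuous_measurable_fun (@sqrt_continuous R).
  by apply: measurable_funD; apply: measurable_funX.
by apply/funext => x /=; case: (f x).
Qed.

Variables (p : \bar R) (p1 : (1 <= p)%E).

Lemma finite_norm_le (f g : T -> R) :
  measurable_fun setT f -> measurable_fun setT g ->
  (forall x, `|f x| <= `|g x|) ->
  finite_norm mu p g -> finite_norm mu p f.
Proof.
move=> mf mg fg; rewrite /finite_norm; apply: le_lt_trans.
rewrite unlock; case: p p1 => [r r1| _|//].
  have r0 : 0 <= r by rewrite (le_trans ler01)// -lee_fin.
  have mr (h : T -> R) : measurable_fun setT h ->
      measurable_fun setT (fun x => (`|(EFin \o h) x| `^ r)%E).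
    move=> mh; apply/measurable_EFinP.
    apply: (@measurableT_comp _ _ _ _ _ _ (@powR R ^~ r)) => //.
    exact: measurableT_comp.
  apply: gt0_ler_poweR; rewrite ?invr_ge0//.
  - by rewrite in_itv/= leey integral_ge0// => x _; rewrite poweR_ge0.
  - by rewrite in_itv/= leey integral_ge0// => x _; rewrite poweR_ge0.
  - apply: ge0_le_integral => //; [|exact: mr|exact: mr|].
      by move=> x _; rewrite poweR_ge0.
    move=> x _; apply: gt0_ler_poweR; rewrite ?in_itv/= ?leey ?andbT ?lee_fin//.
case: ifPn => // _; apply: le_ess_sup; apply: nearW => x /=.
by rewrite lee_fin.
Qed.

Lemma normc_nneg (z : R[i]) : 0 <= normc z.
Proof. by case: z => x y; exact: sqrtr_ge0. Qed.

Lemma normcD (z w : R[i]) : normc (z + w) <= normc z + normc w.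
Proof. exact: le_normcD. Qed.

Lemma cLfun_submod_closed : submod_closed (cLfun p).
Proof.
split.
  apply/mem_set; split; first exact: cmeasurable_cst.
  rewrite (_ : (fun _ => _) = cst 0); first exact: finite_norm_cst0.
  by apply/funext => x; exact: normc0.
move=> a f g /set_mem[mf nf] /set_mem[mg ng].
have ma : cmeasurable (fun x => a * f x).
  by apply: cmeasurableM => //; exact: cmeasurable_cst.
have mh : cmeasurable (a *: f + g) by exact: cmeasurableD.
apply/mem_set; split => //.
have Lf : (fun x => normc (f x)) \in Lfun mu p.
  by rewrite inE; apply/andP; split; apply/mem_set => //; exact: cmeasurable_normc.
have Lg : (fun x => normc (g x)) \in Lfun mu p.
  by rewrite inE; apply/andP; split; apply/mem_set => //; exact: cmeasurable_normc.
have := (Lfun_submod_closed mu p1).2 (normc a) _ _ Lf Lg.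
move=> /[!inE]/andP[/set_mem/= mk /set_mem/= nk].
apply: finite_norm_le nk => //; first exact: cmeasurable_normc.
move=> x; rewrite ger0_norm ?normc_nneg//; apply: le_trans (ler_norm _).
by rewrite (le_trans (normcD _ _))// normcM.
Qed.

End ComplexLebesgue.

Section MultiplicativeMeasure.
Variable R : realType.
Local Notation lambda := (@lebesgue_measure R).
Local Notation Rpos := (`]0%R, +oo[%classic : set R).

(* The measure r^-1 dr on R_+ = ]0, +oo[, as a measure on R that vanishes on
   ]-oo, 0]: functions on R modulo rpos_haar-a.e. equality are functions on R_+
   modulo a.e. equality. *)
Definition rpos_haar (A : set (measurableTypeR R)) : \bar R :=
  (\int[lambda]_(r in A `&` Rpos) (r^-1)%:E)%E.

Lemma measurable_inv_Rpos : measurable_fun Rpos (fun r : R => (r^-1)%:E).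
Proof.
apply/measurable_EFinP; apply: open_continuous_measurable_fun.
  exact: interval_open.
move=> r /set_mem; rewrite /= in_itv/= andbT => r0.
by apply: inv_continuous; rewrite gt_eqF.
Qed.

Lemma rpos_haar0 : rpos_haar set0 = 0%E.
Proof. by rewrite /rpos_haar set0I integral_set0. Qed.

Lemma inv_Rpos_ge0 (A : set R) (r : R) :
  (A `&` Rpos) r -> (0 <= (r^-1)%:E)%E.
Proof. by move=> [_] /=; rewrite in_itv/= andbT lee_fin invr_ge0 => /ltW. Qed.

Lemma rpos_haar_ge0 A : (0 <= rpos_haar A)%E.
Proof. by apply: integral_ge0 => r; exact: inv_Rpos_ge0. Qed.

Lemma rpos_haar_sigma_additive : semi_sigma_additive rpos_haar.
Proof.
move=> F mF tF mUF; rewrite /rpos_haar; apply: cvg_toP.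
  apply: ereal_nondecreasing_is_cvgn => m n mn.
  by apply: lee_sum_nneg_natr => // k _ _; exact: rpos_haar_ge0.
rewrite setI_bigcupl ge0_integral_bigcup//=.
- by move=> k; exact: measurableI.
- rewrite -setI_bigcupl; apply: measurable_funS measurable_inv_Rpos => //.
- by rewrite -setI_bigcupl => r; exact: inv_Rpos_ge0.
- exact: trivIset_setIr.
Qed.

HB.instance Definition _ := isMeasure.Build _ _ _
  rpos_haar rpos_haar0 rpos_haar_ge0 rpos_haar_sigma_additive.

Definition dilation (a : R) (r : measurableTypeR R) : measurableTypeR R :=
  (a * r)%R.

Lemma measurable_dilation a : measurable_fun setT (dilation a).
Proof. exact: mulrl_measurable. Qed.

HB.instance Definition _ a :=
  isMeasurableFun.Build _ _ _ _ (dilation a) (measurable_dilation a).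

Lemma lebesgue_measure_dilation (a : R) (a0 : 0 < a) (A : set R) :
  measurable A ->
  lambda A = (a%:E * lambda (dilation a @^-1` A))%E.
Proof.
move=> mA; pose k : {nonneg R} := NngNum (ltW a0).
apply: (@lebesgue_measure_unique R
  (mscale k (pushforward lambda (dilation a)))) => //.
move=> _ [[u v] /= uv <-].
rewrite /mscale /= /pushforward /=.
rewrite (_ : _ @^-1` _ = `]a^-1 * u, a^-1 * v]%classic); last first.
  apply/seteqP; split => r /=; rewrite !in_itv/=.
    by move=> /andP[h1 h2]; rewrite ltr_pdivrMl// ler_pdivlMl// h1.
  by rewrite ltr_pdivrMl// ler_pdivlMl.
rewrite !lebesgue_measure_itv/= !lte_fin ltr_pM2l ?invr_gt0//.
case: ifPn => _; last by rewrite mule0.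
by rewrite -!EFinB -EFinM -mulrBr mulrA mulfV ?gt_eqF// mul1r.
Qed.

Lemma rpos_haar_dilation (a : R) (a0 : 0 < a) (A : set R) :
  measurable A -> rpos_haar A = rpos_haar (dilation a @^-1` A).
Proof.
move=> mA; pose k : {nonneg R} := NngNum (ltW a0).
have mAR : measurable (A `&` Rpos) by exact: measurableI.
have mw : measurable_fun (A `&` Rpos) (fun r : R => (r^-1)%:E).
  exact: measurable_funS measurable_inv_Rpos.
rewrite /rpos_haar
  (@eq_measure_integral _ _ _ _ (mscale k (pushforward lambda (dilation a)))).
  rewrite ge0_integral_mscale//; last by move=> r; exact: inv_Rpos_ge0.
  rewrite ge0_integral_pushforward//; last first.
    by move=> r /set_mem; exact: inv_Rpos_ge0.
  have -> : dilation a @^-1` (A `&` Rpos) = (dilation a @^-1` A) `&` Rpos.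
    apply/seteqP; split => r /=; rewrite !in_itv/= !andbT /dilation.
      by rewrite pmulr_rgt0.
    by rewrite pmulr_rgt0.
  rewrite -ge0_integralZl//=.
  - apply: eq_integral => r /set_mem[_]/=; rewrite in_itv/= andbT => r0.
    by rewrite -EFinM /dilation invfM mulrA mulfV ?gt_eqF// mul1r.
  - apply: measurableI => //.
    by rewrite -[X in measurable X]setTI; exact: measurable_dilation.
  - apply: (@measurable_comp _ _ _ _ _ _ Rpos (fun r : R => (r^-1)%:E)) => //.
    + move=> _ [r [_ /= + ] <-]; rewrite !in_itv/= !andbT => r0.
      by rewrite /dilation pmulr_rgt0.
    + exact: measurable_inv_Rpos.
    + exact: measurable_funTS (measurable_dilation a).
  - move=> r [_ /=]; rewrite in_itv/= andbT => r0.
    by rewrite lee_fin invr_ge0 pmulr_rge0// ltW.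
  - by rewrite lee_fin ltW.
by move=> B mB _; exact: lebesgue_measure_dilation.
Qed.

Lemma finite_norm_dilation (a : R) (h : measurableTypeR R -> R) :
  0 < a -> measurable_fun setT h ->
  finite_norm rpos_haar 2%:E h -> finite_norm rpos_haar 2%:E (h \o dilation a).
Proof.
move=> a0 mh; rewrite /finite_norm unlock.
suff -> : (\int[rpos_haar]_r (`|(EFin \o h) r| `^ 2) =
    \int[rpos_haar]_r (`|(EFin \o (h \o dilation a)) r| `^ 2))%E by [].
rewrite (@eq_measure_integral _ _ _ _ (pushforward rpos_haar (dilation a))).
  rewrite ge0_integral_pushforward//; last first.
  - by move=> r _; rewrite poweR_ge0.
  - apply/measurable_EFinP.
    apply: (@measurableT_comp _ _ _ _ _ _ (@powR R ^~ 2)) => //.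
    exact: measurableT_comp.
by move=> A mA _; exact: rpos_haar_dilation.
Qed.

End MultiplicativeMeasure.

Section L2.
Variable R : realType.
Local Notation nu := (@rpos_haar R).
Local Notation two := (2%:E : \bar R).

Lemma cLfun2_submod_closed : submod_closed (cLfun nu two).
Proof. exact: cLfun_submod_closed (lee1n 2). Qed.

HB.instance Definition _ :=
  GRing.isSubmodClosed.Build R[i] (measurableTypeR R -> R[i]) (cLfun nu two)
    cLfun2_submod_closed.

Record L2fun := MkL2fun {
  L2val :> measurableTypeR R -> R[i];
  L2valP : L2val \in cLfun nu two }.

HB.instance Definition _ := [isSub for L2val].
HB.instance Definition _ := [Choice of L2fun by <:].
HB.instance Definition _ := [SubChoice_isSubLmodule of L2fun by <:].

Definition L2null : {pred L2fun} :=
  mem [set f : L2fun | {ae nu, forall r, f r = 0}].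

Lemma L2null_submod_closed : submod_closed L2null.
Proof.
split; first by apply/mem_set; apply: nearW.
move=> a f g /set_mem f0 /set_mem g0; apply/mem_set.
by apply: filterS2 f0 g0 => r /= fr gr; rewrite !fctE fr gr scaler0 addr0.
Qed.

HB.instance Definition _ :=
  GRing.isSubmodClosed.Build R[i] L2fun L2null L2null_submod_closed.

(* L^2(R_+, r^-1 dr): complex square-integrable functions modulo null ones. *)
Definition L2 : Type := Quotient.quot L2null.

HB.instance Definition _ := GRing.Zmodule.on L2.
HB.instance Definition _ := EqQuotient.on L2.

Local Open Scope quotient_scope.

Lemma L2_eqP (f g : L2fun) :
  \pi_L2 f = \pi_L2 g <-> {ae nu, forall r, f r = g r}.
Proof.
split=> [/eqP|fg].
  rewrite -Quotient.idealrBE => /set_mem; apply: filterS => r /= /eqP.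
  by rewrite !fctE subr_eq0 => /eqP.
apply/eqP; rewrite -Quotient.idealrBE; apply/mem_set.
by apply: filterS fg => r /= fg; rewrite !fctE fg subrr.
Qed.

(* Operations on classes go through the canonical representative repr; the
   lemmas below show that the result does not depend on that choice. *)
Definition L2scale (c : R[i]) (psi : L2) : L2 := \pi_L2 (c *: repr psi).

Lemma pi_scale (c : R[i]) (f : L2fun) : L2scale c (\pi_L2 f) = \pi_L2 (c *: f).
Proof.
apply/eqP; rewrite -Quotient.idealrBE -scalerBr rpredZ//.
by rewrite Quotient.idealrBE reprK.
Qed.

Lemma pi_add (f g : L2fun) : \pi_L2 f + \pi_L2 g = \pi_L2 (f + g).
Proof. by apply: esym; exact: (@Quotient.pi_add _ L2null). Qed.

Lemma L2scaleA a b psi : L2scale a (L2scale b psi) = L2scale (a * b) psi.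
Proof. by rewrite [L2scale b _]/L2scale pi_scale scalerA. Qed.

Lemma L2scale1 : left_id 1 L2scale.
Proof. by move=> psi; rewrite /L2scale scale1r reprK. Qed.

Lemma L2scaleDr : right_distributive L2scale +%R.
Proof.
move=> a psi phi; rewrite -[psi]reprK -[phi]reprK.
by rewrite pi_add !pi_scale pi_add scalerDr.
Qed.

Lemma L2scaleDl psi : {morph L2scale^~ psi : a b / a + b}.
Proof. by move=> a b; rewrite /L2scale pi_add scalerDl. Qed.

HB.instance Definition _ := GRing.Zmodule_isLmodule.Build R[i] L2
  L2scaleA L2scale1 L2scaleDr L2scaleDl.

Definition L2norm (psi : L2) : R :=
  fine (Lnorm nu two (fun r => (normc (repr psi r))%:E)).

(* Linear in the first argument. *)
Definition inner (psi phi : L2) : R[i] :=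
  cintegral nu (fun r => repr psi r * (repr phi r)^*%C).

Definition bounded_operator (S : L2 -> L2) : Prop :=
  linear S /\ exists M : R, forall psi, L2norm (S psi) <= M * L2norm psi.

End L2.

Section Affine.
Variable R : realType.
Local Notation lambda := (@lebesgue_measure R).
Local Notation halfplane := [set p : R * R | 0 < p.2].

(* Pairs (x, a) with a > 0; set_type gives the subspace topology of R * R. *)
Definition Aff : Type := set_type halfplane.

HB.instance Definition _ := Topological.on Aff.

Definition affx (g : Aff) : R := (set_val g).1.
Definition affa (g : Aff) : R := (set_val g).2.

Lemma affa_gt0 (g : Aff) : 0 < affa g.
Proof. by case: g => p pg; exact: set_mem pg. Qed.

Definition mkAff (x a : R) (a0 : 0 < a) : Aff :=
  exist _ (x, a) (@mem_set _ halfplane (x, a) a0).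

Definition aff1 : Aff := mkAff 0 ltr01.

Definition affmul (g h : Aff) : Aff :=
  mkAff (affa g * affx h + affx g) (mulr_gt0 (affa_gt0 g) (affa_gt0 h)).

(* (x, a) |-> (- x, a); this is not the group inverse. *)
Definition affopx (g : Aff) : Aff := mkAff (- affx g) (affa_gt0 g).

HB.instance Definition _ := isPointed.Build Aff aff1.

(* The trace on Aff of the Borel sigma-algebra of R * R. *)
HB.instance Definition _ := Measurable.copy Aff
  (g_sigma_algebra_preimageType (set_val : Aff -> R * R)).

(* dx da / a. Only its null sets matter for L^oo, and they are those of the
   left Haar measure dx da / a^2 and of the Lebesgue measure. *)
Definition right_haar (A : set Aff) : \bar R :=
  (\int[(lambda \x lambda)]_(p in set_val @` A) (p.2^-1)%:E)%E.

Lemma measurable_halfplane : measurable halfplane.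
Proof.
rewrite (_ : halfplane = setT `*` `]0, +oo[%classic).
  exact: measurableX.
by apply/seteqP; split => p /=; rewrite in_itv/= andbT //; case.
Qed.

Lemma measurable_inv_snd :
  measurable_fun halfplane (fun p : R * R => (p.2^-1)%:E).
Proof.
rewrite (_ : (fun _ => _) = (fun r : R => (r^-1)%:E) \o snd)//.
apply: (measurable_comp
  (F := (`]0%R, +oo[%classic : set (measurableTypeR R)))) => //.
- by move=> _ [p p0 <-]; rewrite /= in_itv/= andbT.
- exact: measurable_inv_Rpos.
- exact: measurable_funTS.
Qed.

Lemma image_halfplane (A : set Aff) : set_val @` A `<=` halfplane.
Proof. by move=> _ [g _ <-]; exact: affa_gt0. Qed.

Lemma measurable_image_halfplane (A : set Aff) :
  measurable A -> measurable (set_val @` A : set (R * R)).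
Proof.
move=> [B mB <-].
rewrite (_ : _ @` _ = halfplane `&` B).
  by apply: measurableI => //; exact: measurable_halfplane.
apply/seteqP; split => [_ [g [_ Bg] <-]|p [p0 Bp]].
  by split => //; exact: affa_gt0.
by exists (exist _ p (mem_set p0)).
Qed.

Lemma right_haar0 : right_haar set0 = 0%E.
Proof. by rewrite /right_haar image_set0 integral_set0. Qed.

Lemma inv_snd_ge0 (A : set Aff) (p : R * R) :
  (set_val @` A) p -> (0 <= (p.2^-1)%:E)%E.
Proof. by move=> /image_halfplane p0; rewrite lee_fin invr_ge0 ltW. Qed.

Lemma right_haar_ge0 A : (0 <= right_haar A)%E.
Proof. by apply: integral_ge0 => p; exact: inv_snd_ge0. Qed.

Lemma right_haar_sigma_additive : semi_sigma_additive right_haar.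
Proof.
move=> F mF tF mUF; rewrite /right_haar; apply: cvg_toP.
  apply: ereal_nondecreasing_is_cvgn => m n mn.
  by apply: lee_sum_nneg_natr => // k _ _; exact: right_haar_ge0.
rewrite image_bigcup ge0_integral_bigcup//=.
- by move=> k; exact: measurable_image_halfplane.
- rewrite -image_bigcup; apply: measurable_funS measurable_inv_snd.
    exact: measurable_halfplane.
  exact: image_halfplane.
- by rewrite -image_bigcup => p; exact: inv_snd_ge0.
- move=> i j _ _ [_ [[g Fi <-] [h Fj /val_inj hg]]].
  by apply: tF => //; exists g; split => //; rewrite -hg.
Qed.

HB.instance Definition _ := isMeasure.Build _ _ _
  right_haar right_haar0 right_haar_ge0 right_haar_sigma_additive.

(* e^{it} *)
Definition expi (t : R) : R[i] := cos t +i* sin t.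

(* U(x, a) f (r) = e^{2 pi i x r} f (a r) *)
Definition Ufun (g : Aff) (f : measurableTypeR R -> R[i]) :
    measurableTypeR R -> R[i] :=
  fun r => expi (2 * pi * affx g * r) * f (affa g * r).

Lemma normc_expi t : normc (expi t) = 1.
Proof. by rewrite /normc/= cos2Dsin2 sqrtr1. Qed.

Lemma Ufun_L2 g f : f \in cLfun (@rpos_haar R) 2%:E ->
  Ufun g f \in cLfun (@rpos_haar R) 2%:E.
Proof.
move=> /set_mem[[mRe mIm] nf]; apply/mem_set.
have mU : cmeasurable (Ufun g f).
  apply: cmeasurableM.
    split.
      apply: (@measurableT_comp _ _ _ _ _ _ (@cos R)).
        exact: continuous_measurable_fun (@continuous_cos R).
      exact: mulrl_measurable.
    apply: (@measurableT_comp _ _ _ _ _ _ (@sin R)).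
      exact: continuous_measurable_fun (@continuous_sin R).
    exact: mulrl_measurable.
  split.
    exact: measurableT_comp mRe (measurable_dilation (affa g)).
  exact: measurableT_comp mIm (measurable_dilation (affa g)).
split => //.
rewrite (_ : (fun _ => _) = (fun r => normc (f r)) \o dilation (affa g)).
  apply: finite_norm_dilation nf; first exact: affa_gt0.
  exact: cmeasurable_normc.
by apply/funext => r; rewrite /Ufun normcM normc_expi mul1r.
Qed.

Definition UL2fun (g : Aff) (f : L2fun R) : L2fun R :=
  MkL2fun (Ufun_L2 g (L2valP f)).

Local Open Scope quotient_scope.

Definition U (g : Aff) (psi : L2 R) : L2 R := \pi_(L2 R) (UL2fun g (repr psi)).

Lemma U_pi g (f : L2fun R) : U g (\pi_(L2 R) f) = \pi_(L2 R) (UL2fun g f).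
Proof.
apply/L2_eqP.
have /L2_eqP[N [mN N0 fN]] : \pi_(L2 R) (repr (\pi_(L2 R) f)) = \pi_(L2 R) f.
  exact: reprK.
exists (dilation (affa g) @^-1` N); split.
- by rewrite -[X in measurable X]setTI; exact: measurable_dilation.
- by rewrite -rpos_haar_dilation//; exact: affa_gt0.
- move=> r /= Ur; apply: fN => /= fr; apply: Ur.
  by rewrite /Ufun /= fr.
Qed.

Definition Linfty : {pred Aff -> R[i]} := cLfun right_haar +oo%E.

(* Q_S(psi, phi)(x, a) = <S U(-x, a) psi, U(-x, a) phi> *)
Definition Cohen (S : L2 R -> L2 R) (psi phi : L2 R) (g : Aff) : R[i] :=
  inner (S (U (affopx g) psi)) (U (affopx g) phi).

(* L^oo(Aff)-valued maps are used at points of Aff, through the continuous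
   representatives, hence the pointwise formulation. *)
Definition sesquilinear (Q : L2 R -> L2 R -> Aff -> R[i]) : Prop :=
  (forall c psi1 psi2 phi g,
    Q (c *: psi1 + psi2) phi g = c * Q psi1 phi g + Q psi2 phi g) /\
  (forall c psi phi1 phi2 g,
    Q psi (c *: phi1 + phi2) g = c^*%C * Q psi phi1 g + Q psi phi2 g).

End Affine.

(* Main.v *)
Require Import Defs.
From mathcomp Require Import all_boot all_order all_algebra.
From mathcomp Require Import complex.
From mathcomp Require Import all_classical all_reals all_analysis measurable_realfun.
From mathcomp Require Import ring lra.
Import Order.TTheory GRing.Theory Num.Theory.
Import numFieldNormedType.Exports.
Import ComplexField.Normc.

(** The covariance property evaluated at the identity reads
    [Q psi phi g = B (U (affopx g) psi) (U (affopx g) phi)] for the single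
    sesquilinear form [B psi phi = Q psi phi (aff1 R)], so that [Q = Cohen S]
    amounts to [B psi phi = inner (S psi) phi] for all [psi] and [phi].
    The boundedness of [B] gives exactly one such [S] by the Riesz
    representation theorem, and [S] is linear and bounded because [B] is
    ([bounded_sesquilinear_representation]).

    Two facts carry the argument. The first is the Riesz theorem in a complete
    semi-inner product space ([riesz]), proved by minimising the energy
    [Re (ip h h) - 2 Re (l h)]. A discriminant computation shows that a
    near-minimiser [f] nearly solves the equation: the functional
    [Re (ip f h - l h)] has small norm. This one estimate shows both that a
    minimising sequence is Cauchy and that its limit represents [l].

    The second is the completeness of complex L^2 ([riesz_fischer]). For
    functions F_n with ||F_m - F_n||^2 <= 16^-n whenever n <= m, the series
    of the 4^k |F_{k+1} - F_k|^2 has a finite integral, hence converges almost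
    everywhere. There the F_n converge pointwise, and Fatou's lemma carries
    the bounds on ||F_m - F_n|| over to the limit. *)

Set Implicit Arguments.
Unset Strict Implicit.
Unset Printing Implicit Defensive.

Local Open Scope ring_scope.

(** * Riesz representation in a complete semi-inner product space *)

(** Each near-minimality and Cauchy-Schwarz estimate below is the non-positivity
    of a discriminant; the leading coefficient [a] is allowed to vanish since
    it will be the squared norm of an arbitrary vector. *)
Lemma quadratic_ge0_discr (R : realFieldType) (a b e : R) :
  0 <= a -> 0 <= e -> (forall t, 0 <= t ^+ 2 * a + 2 * t * b + e) ->
  b ^+ 2 <= e * a.
Proof.
move=> a0 e0 pos; have [aE|an0] := eqVneq a 0.
  have [->|bn0] := eqVneq b 0; first by rewrite expr0n mulr_ge0.
  have := pos (- (e + 1) / (2 * b)); rewrite aE mulr0 add0r.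
  have -> : 2 * (- (e + 1) / (2 * b)) * b = - (e + 1) by field.
  lra.
have agt0 : 0 < a by rewrite lt_def an0.
have := pos (- b / a).
have -> : (- b / a) ^+ 2 * a + 2 * (- b / a) * b + e = (e * a - b ^+ 2) / a.
  by field.
by rewrite pmulr_lge0 ?invr_gt0// subr_ge0.
Qed.

Record semi_inner_product (R : realType) (V : lmodType R[i]) (ip : V -> V -> R[i])
  : Prop := SemiInnerProduct {
  ip_linear : forall c u v w, ip (c *: u + v) w = c * ip u w + ip v w;
  ip_conj : forall u v, ip v u = (ip u v)^*%C;
  ip_ge0 : forall u, 0 <= complex.Re (ip u u) }.

Section Riesz.
Context (R : realType) (V : lmodType R[i]) (ip : V -> V -> R[i]).
Context (ipP : semi_inner_product ip).
Let q v := complex.Re (ip v v).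

Lemma ipDl u v w : ip (u + v) w = ip u w + ip v w.
Proof. by rewrite -[u]scale1r (ip_linear ipP) mul1r scale1r. Qed.

Lemma ip0l w : ip 0 w = 0.
Proof. by apply: (addrI (ip 0 w)); rewrite -ipDl !addr0. Qed.

Lemma ipZl c u w : ip (c *: u) w = c * ip u w.
Proof. by rewrite -[c *: u]addr0 (ip_linear ipP) ip0l addr0. Qed.

Lemma ipBl u v w : ip (u - v) w = ip u w - ip v w.
Proof. by rewrite ipDl -scaleN1r ipZl mulN1r. Qed.

Lemma ipZr c u w : ip w (c *: u) = c^*%C * ip w u.
Proof. by rewrite (ip_conj ipP) ipZl rmorphM/= -(ip_conj ipP). Qed.

Lemma normsq_addZ u h (t : R) :
  q (u + t%:C%C *: h) = q u + 2 * t * complex.Re (ip u h) + t ^+ 2 * q h.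
Proof.
rewrite /q ipDl (ip_conj ipP) ipDl ipZl rmorphD/= rmorphM/=.
rewrite -(ip_conj ipP) ipZl [ip h (_ + _)](ip_conj ipP) ipDl ipZl.
rewrite (ip_conj ipP u h).
case: (ip u h) (ip u u) (ip h h) => [x y] [x1 y1] [x2 y2] /=.
ring.
Qed.

Lemma cauchy_schwarz_Re u h : complex.Re (ip u h) ^+ 2 <= q u * q h.
Proof.
apply: quadratic_ge0_discr; rewrite ?ip_ge0// => t.
by have := ip_ge0 ipP (u + t%:C%C *: h); rewrite -/(q _) normsq_addZ; lra.
Qed.

(** Every Cauchy sequence has a subsequence with this geometric rate of
    convergence, so this is the completeness of the seminorm. *)
Context (ip_complete : forall f : nat -> V,
  (forall n m, (n <= m)%N -> q (f m - f n) <= 16^-1 ^+ n) ->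
  exists u, forall n, q (u - f n) <= 16^-1 ^+ n).

(** The functional [l] is antilinear because [h] is the second argument of [ip].
    The limit [u] of a minimising sequence of the energy makes the defect
    [D u h = Re (ip u h - l h)] vanish for all [h]; replacing [h] by [i h] gives
    the equality of the imaginary parts. *)
Lemma riesz (l : V -> R[i]) (K : R) :
  (forall c u v, l (c *: u + v) = c^*%C * l u + l v) ->
  0 <= K -> (forall h, normc (l h) ^+ 2 <= K * q h) ->
  exists u, forall h, l h = ip u h.
Proof.
move=> l_anti K0 lK.
have lD u v : l (u + v) = l u + l v.
  by rewrite -[u]scale1r l_anti rmorph1 mul1r scale1r.
have lZ c v : l (c *: v) = c^*%C * l v.
  have l0 : l 0 = 0 by apply: (addrI (l 0)); rewrite -lD !addr0.
  by rewrite -[c *: v]addr0 l_anti l0 addr0.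
pose Phi h := q h - 2 * complex.Re (l h).
have PhiK h : - K <= Phi h.
  have := ip_ge0 ipP h; rewrite -/(q h) => qh0.
  have : complex.Re (l h) ^+ 2 <= K * q h.
    apply: le_trans (lK h); case: (l h) => x y /=.
    by rewrite sqr_sqrtr ?addr_ge0 ?sqr_ge0// lerDl sqr_ge0.
  rewrite /Phi; move: (complex.Re _) (q h) qh0 => x s s0 xs.
  suff : `|2 * x| <= s + K by move=> /ler_normlW; lra.
  rewrite -ler_sqr ?nnegrE ?normr_ge0 ?addr_ge0// real_normK ?num_real//.
  by have := sqr_ge0 (s - K); nra.
have Phi_inf : has_inf (range Phi).
  by split; [exists (Phi 0), 0 | exists (- K) => _ [h _ <-]].
(* The squared distance of f n and f m will be at most 2 (e n + e m), hence at
   most 4 e n = 16^-n for n <= m, the rate that completeness assumes. *)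
pose e n : R := 4^-1 * 16^-1 ^+ n.
have e0 n : 0 < e n by rewrite mulr_gt0 ?exprn_gt0 ?invr_gt0.
have /choice[f fP] n : exists f, Phi f < inf (range Phi) + e n.
  by have [_ [h _ <-]] := inf_adherent (e0 n) Phi_inf; exists h.
pose D u h := complex.Re (ip u h) - complex.Re (l h).
have fD n h : D (f n) h ^+ 2 <= e n * q h.
  (* Moving from f n by t h cannot lower Phi by more than e n. *)
  apply: quadratic_ge0_discr; rewrite ?ip_ge0 ?(ltW (e0 n))// => t.
  have : inf (range Phi) <= Phi (f n + t%:C%C *: h).
    by apply: ge_inf; [exact: Phi_inf.2|exists (f n + t%:C%C *: h)].
  have := fP n; rewrite /Phi normsq_addZ lD lZ /D.
  have -> : complex.Re (l (f n) + t%:C%C^*%C * l h) =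
     complex.Re (l (f n)) + t * complex.Re (l h).
    by case: (l (f n)) (l h) => [x y] [x1 y1] /=; ring.
  lra.
have [|u uP] := @ip_complete f.
  move=> n m nm.
  have e_mn : e m <= e n.
    by rewrite ler_pM2l ?invr_gt0//; apply: ler_wiXn2l => //; lra.
  (* Testing both defects against h = f m - f n itself recovers q h. *)
  set h := f m - f n; have := ip_ge0 ipP h; rewrite -/(q h) => qh0.
  have : q h = D (f m) h - D (f n) h.
    rewrite /D {1}/q {1}/h ipBl.
    by case: (ip (f m) h) (ip (f n) h) => [x y] [x1 y1] /=; ring.
  have := fD m h; have := fD n h.
  have := e0 n; rewrite /e in e_mn *; move: (16^-1 ^+ n) (16^-1 ^+ m) e_mn => en em emn en0.
  move: (D _ _) (D _ _) (q h) qh0 => y x s s0 ys xs sE.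
  have [//|sgt] := leP s en.
  have ss : s ^+ 2 <= en * s.
    have := sqr_ge0 (x + y).
    have : em * s <= en * s by rewrite ler_wpM2r//; lra.
    rewrite sE; nra.
  nra.
have Du0 h : D u h = 0.
  have Dn n : D u h ^+ 2 <= geometric (4 * q h) 16^-1 n.
    have := fD n h; have := cauchy_schwarz_Re (u - f n) h.
    have := ip_ge0 ipP h; rewrite -/(q h) => qh0 cs fDn.
    have csn := le_trans cs (ler_wpM2r qh0 (uP n)).
    have -> : D u h = D (f n) h + complex.Re (ip (u - f n) h).
      rewrite /D ipBl.
      by case: (ip u h) (ip (f n) h) => [x y] [x1 y1] /=; ring.
    rewrite /e /= in fDn csn *.
    have := sqr_ge0 (D (f n) h - complex.Re (ip (u - f n) h)).
    move: (D _ _) (complex.Re _) (16^-1 ^+ n) fDn csn => x y en.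
    move=> xe ye; have := le_trans (sqr_ge0 y) ye; nra.
  have lt1 : `|16^-1| < 1 :> R by rewrite ger0_norm; lra.
  apply/eqP; rewrite -sqrf_eq0 eq_le sqr_ge0 andbT.
  have := cvg_geometric (4 * q h) lt1.
  move/[dup] => /cvg_lim <- // cv; apply: limr_ge; first exact: cvgP cv.
  exact: nearW.
exists u => h.
have := Du0 h; have := Du0 ('i%C *: h); rewrite /D ipZr lZ.
case: (ip u h) (l h) => [x y] [x1 y1] /=.
move=> *; apply/eqP; rewrite eq_complex /=; apply/andP; split; apply/eqP; lra.
Qed.
End Riesz.

(** * Complex square-integrable functions and their inner product *)

Lemma normc_sqrE (R : rcfType) (z : R[i]) :
  normc z ^+ 2 = complex.Re z ^+ 2 + complex.Im z ^+ 2.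
Proof. by case: z => x y; rewrite /= sqr_sqrtr ?addr_ge0 ?sqr_ge0. Qed.

Lemma Re_le_normc (R : rcfType) (z : R[i]) : `|complex.Re z| <= normc z.
Proof. by case: z => x y /=; rewrite -sqrtr_sqr ler_wsqrtr// lerDl sqr_ge0. Qed.

Lemma Im_le_normc (R : rcfType) (z : R[i]) : `|complex.Im z| <= normc z.
Proof. by case: z => x y /=; rewrite -sqrtr_sqr ler_wsqrtr// lerDr sqr_ge0. Qed.

Section ComplexIntegral.
Context d (T : measurableType d) (R : realType) (mu : {measure set T -> \bar R}).
Implicit Types f g : T -> R[i].

Definition cintegrable f :=
  mu.-integrable setT (EFin \o (fun x => complex.Re (f x))) /\
  mu.-integrable setT (EFin \o (fun x => complex.Im (f x))).

Lemma cintegralD f g : cintegrable f -> cintegrable g ->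
  cintegral mu (fun x => f x + g x) = cintegral mu f + cintegral mu g.
Proof.
move=> [f1 f2] [g1 g2]; rewrite /cintegral.
rewrite [RHS]/(_ + _)/= -!RintegralD//.
by congr (_ +i* _)%C; apply: eq_Rintegral => x _; case: (f x) (g x) => [? ?] [].
Qed.

Lemma cintegralZ c f : cintegrable f ->
  cintegral mu (fun x => c * f x) = c * cintegral mu f.
Proof.
case: c => a b [f1 f2]; rewrite /cintegral.
have ZL r (h : T -> R) : mu.-integrable setT (EFin \o h) ->
    mu.-integrable setT (EFin \o (fun x => r * h x)).
  by move=> /(@integrableZl _ _ _ _ _ measurableT r); exact: eq_integrable.
rewrite [RHS]/(_ * _)/= -!RintegralZl// -RintegralB//; try exact: ZL.
rewrite -RintegralD//; try exact: ZL.
by congr (_ +i* _)%C; apply: eq_Rintegral => x _; case: (f x).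
Qed.

Lemma cintegral_conj f : cintegrable f ->
  cintegral mu (fun x => (f x)^*%C) = (cintegral mu f)^*%C.
Proof.
move=> [_ f2]; rewrite /cintegral /=; congr (_ +i* _)%C.
  by apply: eq_Rintegral => x _; case: (f x).
rewrite -mulN1r -RintegralZl//; apply: eq_Rintegral => x _.
by rewrite mulN1r; case: (f x).
Qed.

Lemma ae_eq_cintegral f g : cmeasurable f -> cmeasurable g ->
  {ae mu, forall x, f x = g x} -> cintegral mu f = cintegral mu g.
Proof.
move=> [f1 f2] [g1 g2] fg; rewrite /cintegral; congr (_ +i* _)%C; congr fine.
  apply: ae_eq_integral => //; [exact/measurable_EFinP..|].
  by apply: filterS fg => x fgx _; rewrite /= fgx.
apply: ae_eq_integral => //; [exact/measurable_EFinP..|].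
by apply: filterS fg => x fgx _; rewrite /= fgx.
Qed.

Lemma cLfun2_Lfun f : f \in cLfun mu 2%:E ->
  (fun x => complex.Re (f x)) \in Lfun mu 2%:E /\
  (fun x => complex.Im (f x)) \in Lfun mu 2%:E.
Proof.
move=> /set_mem[mf nf]; have mn := cmeasurable_normc mf.
have le2 : (1 <= 2%:E :> \bar R)%E by rewrite lee_fin ler1n.
split; rewrite inE; apply/andP; split; apply/mem_set; try exact: mf.1;
  try exact: mf.2; apply: finite_norm_le nf => //; try exact: mf.1;
  try exact: mf.2; move=> x; rewrite [leRHS]ger0_norm ?normc_nneg//.
  exact: Re_le_normc.
exact: Im_le_normc.
Qed.

Lemma cLfun2_mul_conj f g : f \in cLfun mu 2%:E -> g \in cLfun mu 2%:E ->
  cintegrable (fun x => f x * (g x)^*%C).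
Proof.
move=> /cLfun2_Lfun[f1 f2] /cLfun2_Lfun[g1 g2].
have M h k : h \in Lfun mu 2%:E -> k \in Lfun mu 2%:E ->
    mu.-integrable setT (EFin \o (fun x => h x * k x)).
  by move=> Lh Lk; apply/Lfun1_integrable; exact: Lfun2_mul_Lfun1.
split.
  have := integrableD measurableT (M _ _ f1 g1) (M _ _ f2 g2).
  apply: eq_integrable => // x _ /=; case: (f x) (g x) => [? ?] [? ?] /=.
  by rewrite -EFinD mulrN opprK.
have := integrableB measurableT (M _ _ f2 g1) (M _ _ f1 g2).
apply: eq_integrable => // x _ /=; case: (f x) (g x) => [? ?] [? ?] /=.
by rewrite -EFinB mulrN addrC.
Qed.

(** Kept in the extended reals, so that monotone convergence, Fatou's lemma and
    the finiteness of the L^2 norm are statements about the same quantity. *)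
Definition normsq_int f := (\int[mu]_x (normc (f x) ^+ 2)%:E)%E.

Lemma Lnorm2_normc f : Lnorm mu 2%:E (fun x => (normc (f x))%:E) =
  (normsq_int f `^ 2^-1)%E.
Proof.
rewrite unlock; congr (_ `^ _)%E; apply: eq_integral => x _.
by rewrite /= ger0_norm ?normc_nneg// powR_mulrn ?normc_nneg.
Qed.

Lemma normsq_int_ge0 f : (0 <= normsq_int f)%E.
Proof. by apply: integral_ge0 => x _; rewrite lee_fin sqr_ge0. Qed.

Lemma cLfun2P f : f \in cLfun mu 2%:E <->
  cmeasurable f /\ (normsq_int f < +oo)%E.
Proof.
have E : finite_norm mu 2%:E (fun x => normc (f x)) <-> (normsq_int f < +oo)%E.
  rewrite /finite_norm [X in (X < _)%E](Lnorm2_normc f).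
  split => [|fin]; last exact: poweR_lty.
  by apply: contraTT; rewrite -!leNgt !leye_eq => /eqP ->; rewrite poweRyr.
split=> [/set_mem[mf /E]//|[mf /E nf]]; exact/mem_set.
Qed.

Lemma Re_cintegral_mul_conj f :
  complex.Re (cintegral mu (fun x => f x * (f x)^*%C)) = fine (normsq_int f).
Proof.
rewrite /=; apply: eq_Rintegral => x _.
by rewrite normc_sqrE; case: (f x) => x1 y1 /=; rewrite mulrN opprK -!expr2.
Qed.

End ComplexIntegral.

Section L2inner.
Context (R : realType).
Local Notation nu := (@rpos_haar R).
Local Open Scope quotient_scope.
Implicit Types (f g : L2fun R) (psi phi : L2 R).

Lemma cmeasurable_mul_conj f g : cmeasurable (fun r => f r * (g r)^*%C).
Proof.
have /set_mem[mf _] := L2valP f; have /set_mem[[g1 g2] _] := L2valP g.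
apply: cmeasurableM => //; split.
  rewrite (_ : (fun _ => _) = (fun x => complex.Re (g x)))//.
  by apply/funext => x; case: (g x).
rewrite (_ : (fun _ => _) = (fun x => - complex.Im (g x))).
  exact: measurableT_comp.
by apply/funext => x; case: (g x).
Qed.

Lemma L2ind (P : L2 R -> Prop) : (forall f, P (\pi_(L2 R) f)) -> forall psi, P psi.
Proof. by move=> Pf psi; rewrite -[psi]reprK. Qed.

Lemma repr_pi_ae f : {ae nu, forall r, repr (\pi_(L2 R) f) r = f r}.
Proof. by apply/L2_eqP; exact: reprK. Qed.

Lemma inner_pi f g :
  inner (\pi_(L2 R) f) (\pi_(L2 R) g) = cintegral nu (fun r => f r * (g r)^*%C).
Proof.
apply: ae_eq_cintegral; [exact: cmeasurable_mul_conj..|].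
by apply: filterS2 (repr_pi_ae f) (repr_pi_ae g) => r -> ->.
Qed.

Lemma L2_inner_product : semi_inner_product (@inner R).
Proof.
split=> [c|u v|u].
- elim/L2ind => f; elim/L2ind => g; elim/L2ind => h.
  rewrite [c *: _]Defs.pi_scale Defs.pi_add !inner_pi.
  rewrite -cintegralZ; last by apply: cLfun2_mul_conj; exact: L2valP.
  rewrite -cintegralD; last first.
  + by apply: cLfun2_mul_conj; exact: L2valP.
  + have -> : (fun x => c * (f x * (h x)^*%C)) =
      (fun x => (c *: f) x * (h x)^*%C) by apply/funext => x; rewrite mulrA.
    by apply: (@cLfun2_mul_conj _ _ _ _ (c *: f)); exact: L2valP.
  congr cintegral; apply/funext => r.
  by rewrite mulrA -mulrDl.
- rewrite /inner -cintegral_conj; last first.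
    by apply: cLfun2_mul_conj; exact: L2valP.
  congr cintegral; apply/funext => r.
  by rewrite rmorphM/= conjcK mulrC.
- by rewrite Re_cintegral_mul_conj fine_ge0// normsq_int_ge0.
Qed.

Lemma L2norm_sqr psi : L2norm psi ^+ 2 = complex.Re (inner psi psi).
Proof.
rewrite Re_cintegral_mul_conj /L2norm Lnorm2_normc.
have /cLfun2P[_] := L2valP (repr psi).
have := normsq_int_ge0 nu (repr psi).
case: (normsq_int _ _) => //= s s0 _.
by rewrite -powR_mulrn ?powR_ge0// -powRrM mulVf// powRr1.
Qed.

Lemma L2norm_ge0 psi : 0 <= L2norm psi.
Proof. by rewrite fine_ge0// Lnorm_ge0. Qed.

Lemma inner_definite psi : complex.Re (inner psi psi) = 0 -> psi = 0.
Proof.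
rewrite Re_cintegral_mul_conj => n0.
have /cLfun2P[mf nf] := L2valP (repr psi).
have {nf}n0 : normsq_int nu (repr psi) = 0%E.
  by rewrite -[LHS]fineK ?n0// ge0_fin_numE ?normsq_int_ge0.
rewrite -[psi]reprK -[0](@scale0r _ _ psi) [_ *: _]/(L2scale _ _) /L2scale scale0r.
apply/L2_eqP.
have n0' : (\int[nu]_x `|(normc (repr psi x) ^+ 2)%:E| = 0)%E.
  by rewrite -[RHS]n0; apply: eq_integral => x _; rewrite gee0_abs// lee_fin sqr_ge0.
case: (@ae_eq_integral_abs _ _ _ nu _ measurableT (fun x => (normc (repr psi x) ^+ 2)%:E)).
  by apply/measurable_EFinP; apply: measurable_funX; exact: cmeasurable_normc.
move=> + _ => /(_ n0'); apply: filterS => r /(_ I) /= [] /eqP.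
by rewrite sqrf_eq0 => /eqP /eq0_normc.
Qed.

End L2inner.

(** * Completeness of complex L^2 *)

Lemma nneseries_geometric_lty (R : realType) (z : R) : 0 < z < 1 ->
  (\sum_(0 <= k <oo) (z ^+ k)%:E < +oo)%E.
Proof.
move=> /andP[z0 z1]; apply: (@le_lt_trans _ _ ((1 - z)^-1)%:E); last exact: ltry.
apply: lime_le; first by apply: is_cvg_nneseries => k _ _; rewrite lee_fin exprn_ge0// ltW.
apply: nearW => n; rewrite sumEFin lee_fin.
have := @geometric_le_lim _ n 1 z ler01 z0; rewrite (ger0_norm (ltW z0)) => /(_ z1).
rewrite mul1r; apply: le_trans; rewrite /series /=.
by apply: ler_sum => k _; rewrite mul1r.
Qed.

(** By the inequality s <= t + s^2 / t with t = 4^-k, the steps are dominated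
    by the sum of a geometric series and of the given one. *)
Lemma cvg_weighted_steps (R : realType) (x s : R ^nat) :
  (forall k, `|x k.+1 - x k| <= s k) ->
  (\sum_(0 <= k <oo) (4 ^+ k * s k ^+ 2)%:E < +oo)%E ->
  cvgn x.
Proof.
move=> xs sfin.
have w0 k : 0 <= 4 ^+ k * s k ^+ 2 by rewrite mulr_ge0 ?sqr_ge0 ?exprn_ge0.
have cw : cvgn (series (fun k => 4 ^+ k * s k ^+ 2)).
  apply: nondecreasing_is_cvgn; first exact: nondecreasing_series.
  exists (fine (\sum_(0 <= k <oo) (4 ^+ k * s k ^+ 2)%:E)%E) => _ [n _ <-].
  rewrite -lee_fin fineK.
    rewrite /series/= -sumEFin; apply: nneseries_lim_ge => k _ _.
    by rewrite lee_fin.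
  by rewrite ge0_fin_numE// nneseries_ge0// => k _ _; rewrite lee_fin.
have cg : cvgn (series (geometric (1 : R) 4^-1)).
  by apply: is_cvg_geometric_series; rewrite ger0_norm; lra.
have ct : cvgn [normed series (telescope x)].
  apply: (series_le_cvg (v_ := geometric 1 4^-1 + (fun k => 4 ^+ k * s k ^+ 2))).
  - by move=> k; rewrite normr_ge0.
  - by move=> k; rewrite addr_ge0//= mul1r exprn_ge0// invr_ge0.
  - move=> k; apply: (le_trans (xs k)); rewrite fctE /= mul1r exprVn.
    have : 0 < 4 ^+ k :> R by rewrite exprn_gt0.
    move: (4 ^+ k) (s k) => a b a0.
    have := sqr_ge0 (a * b - 1) => ab.
    rewrite -(ler_pM2l a0) mulrDr divff ?gt_eqF//; nra.
  - exact: is_cvg_seriesD.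
rewrite (_ : x = cst (x 0%N) + series (telescope x)).
  by apply: is_cvgD; [exact: is_cvg_cst|exact: normed_cvg].
by apply/funext => n; rewrite fctE -eq_sum_telescope.
Qed.

Section RieszFischer.
Local Open Scope classical_set_scope.
Local Open Scope ring_scope.
Context d (T : measurableType d) (R : realType) (mu : {measure set T -> \bar R}).
Implicit Types f g : T -> R[i].

Lemma cmeasurableB f g : cmeasurable f -> cmeasurable g ->
  cmeasurable (fun x => f x - g x).
Proof.
move=> mf mg; rewrite (_ : (fun _ => _) = f + (fun x => -1 * g x)).
  by apply/cmeasurableD/cmeasurableM => //; exact: cmeasurable_cst.
by apply/funext => x; rewrite fctE mulN1r.
Qed.

Lemma measurable_normsq f : cmeasurable f ->
  measurable_fun setT (fun x => (normc (f x) ^+ 2)%:E).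
Proof.
by move=> mf; apply/measurable_EFinP/measurable_funX; exact: cmeasurable_normc.
Qed.

(** A candidate for the pointwise limit that is measurable everywhere, whether
    or not the sequence converges: at points of divergence its value is junk. *)
Definition climsup (F : nat -> T -> R[i]) x : R[i] :=
  (fine (limn_esup (fun n => (complex.Re (F n x))%:E)) +i*
   fine (limn_esup (fun n => (complex.Im (F n x))%:E)))%C.

Lemma cmeasurable_climsup (F : nat -> T -> R[i]) :
  (forall n, cmeasurable (F n)) -> cmeasurable (climsup F).
Proof.
move=> mF; split; apply: measurableT_comp => //;
  apply: measurable_fun_limn_esup => n; apply/measurable_EFinP.
  exact: (mF n).1.
exact: (mF n).2.
Qed.

Lemma fine_limn_esup_EFin (x : R ^nat) : cvgn x ->
  x @ \oo --> fine (limn_esup (fun n => (x n)%:E)).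
Proof.
move=> /cvg_ex[l xl].
have : (fun n => (x n)%:E) @ \oo --> l%:E by apply: cvg_EFin => //; exact: nearW.
by move=> /cvg_limn_einf_sup[_ ->].
Qed.

(** Assuming a rate of convergence, rather than only the Cauchy property, makes
    the whole sequence converge almost everywhere, and the limit inherits the
    same rate. *)
Lemma riesz_fischer (F : nat -> T -> R[i]) :
  (forall n, F n \in cLfun mu 2%:E) ->
  (forall n m, (n <= m)%N ->
    (normsq_int mu (fun x => F m x - F n x)%R <= (16^-1 ^+ n)%:E)%E) ->
  exists2 u, u \in cLfun mu 2%:E &
    forall n, (normsq_int mu (fun x => u x - F n x)%R <= (16^-1 ^+ n)%:E)%E.
Proof.
move=> LF cauchyF.
have mF n : cmeasurable (F n) by have /set_mem[] := LF n.
have mB m n : cmeasurable (fun x => F m x - F n x) by exact: cmeasurableB.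
pose s k x := normc (F k.+1 x - F k x).
pose w k x : \bar R := (4 ^+ k * s k x ^+ 2)%:E.
have mw k : measurable_fun setT (w k).
  apply/measurable_EFinP; apply: measurable_funM => //.
  by apply: measurable_funX; exact: cmeasurable_normc.
have w0 k x : (0 <= w k x)%E by rewrite lee_fin mulr_ge0 ?sqr_ge0 ?exprn_ge0.
(* Term by term, the integral of w k is at most 4^k 16^-k = 4^-k. *)
have iw : mu.-integrable setT (fun x => \sum_(0 <= k <oo) w k x)%E.
  apply/integrableP; split; first exact: ge0_emeasurable_sum.
  under eq_integral => x _ do rewrite gee0_abs ?nneseries_ge0//.
  rewrite integral_nneseries//.
  apply: le_lt_trans (nneseries_geometric_lty (z := 4^-1) _); last by lra.
  apply: lee_nneseries => [k _ _|k _]; first by apply: integral_ge0 => x _.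
  rewrite /w; under eq_integral do rewrite EFinM.
  rewrite ge0_integralZl_EFin ?exprn_ge0//; first last.
  - exact: measurable_normsq.
  - by move=> x _; rewrite lee_fin sqr_ge0.
  rewrite (le_trans (lee_wpmul2l _ (cauchyF k k.+1 (leqnSn k))))//.
  rewrite -EFinM lee_fin -exprMn.
  by rewrite (_ : 4 * 16^-1 = 4^-1 :> R)//; lra.
pose u := climsup F; have mu_ : cmeasurable u by exact: cmeasurable_climsup.
have Fu : {ae mu, forall x, (fun n => complex.Re (F n x)) @ \oo --> complex.Re (u x)
    /\ (fun n => complex.Im (F n x)) @ \oo --> complex.Im (u x)}.
  apply: filterS (integrable_ae measurableT iw) => x /(_ I).
  rewrite ge0_fin_numE ?nneseries_ge0// => wfin.
  split; apply: fine_limn_esup_EFin; apply: (cvg_weighted_steps (s := s ^~ x)) => // k.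
    have := Re_le_normc (F k.+1 x - F k x); rewrite /s.
    by case: (F k.+1 x) (F k x) => [? ?] [].
  have := Im_le_normc (F k.+1 x - F k x); rewrite /s.
  by case: (F k.+1 x) (F k x) => [? ?] [].
have Lu n : (normsq_int mu (fun x => u x - F n x)%R <= (16^-1 ^+ n)%:E)%E.
  (* Fatou's lemma for |F m - F n|^2 as m tends to infinity, n being fixed. *)
  pose h m x : \bar R := (normc (F m x - F n x) ^+ 2)%:E.
  have mh m : measurable_fun setT (h m) by exact: measurable_normsq.
  have -> : normsq_int mu (fun x => u x - F n x) =
      (\int[mu]_x limn_einf (h ^~ x))%E.
    apply: ge0_ae_eq_integral => //.
    - by apply: measurable_normsq; exact: cmeasurableB.
    - apply: measurableT_comp => //; apply: measurable_fun_limn_esup => m.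
      exact: measurableT_comp.
    - by move=> x _; rewrite lee_fin sqr_ge0.
    - move=> x _; rewrite limn_einf_lim; apply: lime_ge; first exact: is_cvg_einfs.
      by apply: nearW => m; apply: le_ereal_inf_tmp => _ [k _ <-]; rewrite lee_fin sqr_ge0.
    apply: filterS Fu => x [Fre Fim] _; apply/esym.
    apply: (cvg_limn_einf_sup _).1.
    apply: cvg_EFin; first exact: nearW.
    rewrite normc_sqrE.
    rewrite (_ : fine \o _ = (fun m => (complex.Re (F m x) - complex.Re (F n x)) ^+ 2 +
      (complex.Im (F m x) - complex.Im (F n x)) ^+ 2)); last first.
      by apply/funext => m /=; rewrite normc_sqrE; case: (F m x) (F n x) => [? ?] [].
    rewrite (_ : _ + _ = (complex.Re (u x) - complex.Re (F n x)) ^+ 2 +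
      (complex.Im (u x) - complex.Im (F n x)) ^+ 2); last first.
      by case: (u x) (F n x) => [? ?] [].
    by apply: cvgD; rewrite expr2; under eq_fun do rewrite expr2;
      apply: cvgM; apply: cvgB => //; exact: cvg_cst.
  apply: le_trans (fatou _ _ _ _) _ => //.
    by move=> m x _; rewrite lee_fin sqr_ge0.
  rewrite limn_einf_lim; apply: lime_le; first exact: is_cvg_einfs.
  near=> m; apply: (@le_trans _ _ (\int[mu]_x h m x)%E).
    by apply: ereal_inf_lbound; exists m => /=.
  by apply: cauchyF; near: m; exact: nbhs_infty_ge.
exists u => //.
have : (fun x => u x - F 0%N x) \in cLfun mu 2%:E.
  apply/cLfun2P; split; last exact: le_lt_trans (Lu 0%N) (ltry _).
  exact: cmeasurableB.
move=> LuF; rewrite (_ : u = 1 *: (fun x => u x - F 0%N x) + F 0%N).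
  by apply: (cLfun_submod_closed mu (lee1n 2)).2 => //; exact: LF.
by rewrite scale1r; apply/funext => x; rewrite fctE subrK.
Unshelve. all: by end_near. Qed.
End RieszFischer.

(** * L^2(R_+) as a Hilbert space *)

Section L2Hilbert.
Context (R : realType).
Local Notation nu := (@rpos_haar R).
Local Open Scope quotient_scope.
Implicit Types (f g : L2fun R) (psi phi : L2 R).

Lemma pi_sub f g : \pi_(L2 R) f - \pi_(L2 R) g = \pi_(L2 R) (f - g).
Proof. by rewrite -scaleN1r [_ *: _]Defs.pi_scale Defs.pi_add scaleN1r. Qed.

(** Transfers the squared norms of classes to integrals of representatives, where
    [riesz_fischer] applies. *)
Lemma normsq_int_inner f :
  normsq_int nu f = (complex.Re (inner (\pi_(L2 R) f) (\pi_(L2 R) f)))%:E.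
Proof.
have /cLfun2P[_ nf] := L2valP f.
by rewrite inner_pi Re_cintegral_mul_conj fineK// ge0_fin_numE ?normsq_int_ge0.
Qed.

Lemma L2_complete (F : nat -> L2 R) :
  (forall n m, (n <= m)%N ->
    complex.Re (inner (F m - F n) (F m - F n)) <= 16^-1 ^+ n) ->
  exists u, forall n, complex.Re (inner (u - F n) (u - F n)) <= 16^-1 ^+ n.
Proof.
move=> cauchyF; pose f n := repr (F n).
have FE n : F n = \pi_(L2 R) (f n) by rewrite reprK.
have [n|n m nm|u Lu uP] := @riesz_fischer _ _ _ nu (fun n => f n).
- exact: L2valP.
- by have := cauchyF n m nm; rewrite !FE pi_sub -lee_fin -normsq_int_inner.
exists (\pi_(L2 R) (MkL2fun Lu)) => n.
by rewrite FE pi_sub -lee_fin -normsq_int_inner; exact: uP.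
Qed.

Lemma inner_ext psi psi' :
  (forall phi, inner psi phi = inner psi' phi) -> psi = psi'.
Proof.
move=> E; apply/eqP; rewrite -subr_eq0; apply/eqP/inner_definite.
by rewrite (ipBl (L2_inner_product R)) E subrr.
Qed.

(** Riesz's theorem gives each [S psi] separately; the linearity of [S] follows
    from uniqueness of the representing vector, and its bound from taking
    [phi = S psi]. The bound [`|C|] also covers the case [S psi = 0], where
    division by the norm of [S psi] is impossible. *)
Lemma bounded_sesquilinear_representation (B : L2 R -> L2 R -> R[i]) (C : R) :
  (forall c psi1 psi2 phi, B (c *: psi1 + psi2) phi = c * B psi1 phi + B psi2 phi) ->
  (forall c psi phi1 phi2, B psi (c *: phi1 + phi2) = c^*%C * B psi phi1 + B psi phi2) ->
  (forall psi phi, normc (B psi phi) <= C * L2norm psi * L2norm phi) ->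
  exists S, bounded_operator S /\ forall psi phi, B psi phi = inner (S psi) phi.
Proof.
move=> Bl Br BC.
have /choice[S SP] psi : exists chi, forall phi, B psi phi = inner chi phi.
  apply: (riesz (L2_inner_product R) (@L2_complete) (Br ^~ psi)
    (K := (C * L2norm psi) ^+ 2)); first exact: sqr_ge0.
  move=> phi; rewrite -L2norm_sqr -exprMn ler_sqr ?nnegrE ?normc_nneg//.
  exact: le_trans (normc_nneg _) (BC _ _).
exists S; split=> //; split=> [c psi1 psi2|].
  apply: inner_ext => phi.
  by rewrite (ip_linear (L2_inner_product R)) -!SP Bl.
exists `|C| => psi; have [->|Spsi0] := eqVneq (L2norm (S psi)) 0.
  by rewrite mulr_ge0 ?L2norm_ge0.
have Spsi_gt0 : 0 < L2norm (S psi) by rewrite lt_def Spsi0 L2norm_ge0.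
rewrite -(ler_pM2r Spsi_gt0) -expr2 L2norm_sqr -SP.
apply: le_trans (ler_norm _) (le_trans (Re_le_normc _) (le_trans (BC _ _) _)).
by rewrite -!mulrA ler_wpM2r ?ler_norm// mulr_ge0 ?L2norm_ge0.
Qed.

End L2Hilbert.

(** * Evaluation at the identity of the affine group *)

Section AffineIdentity.
Context (R : realType).

Lemma affmul1 (g : Aff R) : affmul (aff1 R) g = g.
Proof.
case: g => -[x a] p; apply: (@val_inj _ _ (set_type _)) => /=.
by rewrite /affx /affa /= mul1r addr0 mul1r.
Qed.

Lemma U_aff1 (psi : L2 R) : U (affopx (aff1 R)) psi = psi.
Proof.
move: psi; apply: L2ind => f; rewrite U_pi; apply/L2_eqP; apply: nearW => r.
rewrite /= /Ufun /affx /affa /= oppr0 mulr0 mul0r mul1r.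
by rewrite /expi cos0 sin0 mul1r.
Qed.

End AffineIdentity.

Theorem proposition6p11 (R : realType)
    (Q : L2 R -> L2 R -> Aff R -> R[i])
    (Q_Linfty : forall psi phi : L2 R, Q psi phi \in @Linfty R)
    (Q_sesquilinear : sesquilinear Q)
    (Q_continuous : forall psi phi : L2 R,
      continuous (Q psi phi : Aff R -> R[i]^o))
    (Q_covariant : forall (psi phi : L2 R) (g h : Aff R),
      Q (U (affopx g) psi) (U (affopx g) phi) h = Q psi phi (affmul h g))
    (C : R)
    (Q_bounded : forall psi phi : L2 R,
      normc (Q psi phi (aff1 R)) <= C * L2norm psi * L2norm phi) :
  exists! S : L2 R -> L2 R, bounded_operator S /\ Q = Cohen S.
Proof.
have [Ql Qr] := Q_sesquilinear.
have [S [Sb QS]] := bounded_sesquilinear_representation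
  (fun c psi1 psi2 phi => Ql c psi1 psi2 phi (aff1 R))
  (fun c psi phi1 phi2 => Qr c psi phi1 phi2 (aff1 R)) Q_bounded.
exists S; split=> [|S' [_ QS']].
  split=> //; apply/funext => psi; apply/funext => phi; apply/funext => g.
  by rewrite -[in LHS](affmul1 g) -Q_covariant QS.
apply/funext => psi; apply: inner_ext => phi.
by rewrite -QS QS' /Cohen !U_aff1.
Qed.
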